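(* Let $\mathcal{I}_{Lip}^{1}$ and $\mathcal{I}_{Lip}^{2}$ be Lipschitz operator ideals. Then the following assertions are equivalent. (1) The two-Lipschitz operator ideal $\mathcal{B}(\mathcal{I}_{Lip}^{1},\mathcal{I}_{Lip}^{2})$ is symmetric. (2) $\mathcal{B}(\mathcal{I}_{Lip}^{1},\mathcal{I}_{Lip}^{2})=\mathcal{B}(\mathcal{I}_{Lip}^{2},\mathcal{I}_{Lip}^{1})$. (3) $\mathcal{I}_{Lip}^{1}=\mathcal{I}_{Lip}^{2}$.
   Context: Let $\mathbb{K}$ be $\mathbb{R}$ or $\mathbb{C}$; all Banach spaces are over $\mathbb{K}$. A pointed metric space is a metric space with a distinguished base point $0$. $Lip_0(X,Y)$ is the set of Lipschitz maps $T:X\to Y$ with $T(0)=0$; $X^{\#}=Lip_0(X,\mathbb{K})$. $\mathcal{L}(E,F)$ is the space of bounded linear operators and $\mathcal{B}(G_1,G_2;E)$ the space of bounded bilinear operators $G_1\times G_2\to E$. A map $T:X_1\times X_2\to E$ ($X_1,X_2$ pointed metric spaces, $E$ Banach) belongs to $BLip_0(X_1,X_2;E)$ if $T(x_1,0)=T(0,x_2)=0$ for all $x_1,x_2$ and there is $C>0$ with $\|T(x_1,x_2)-T(x_1,x_2')-T(x_1',x_2)+T(x_1',x_2')\|\le C\,d(x_1,x_1')d(x_2,x_2')$ for all $x_1,x_1'\in X_1$, $x_2,x_2'\in X_2$. A Lipschitz operator ideal $\mathcal{I}_{Lip}$ is a subclass of $Lip_0$ such that for every pointed metric space $X$ and Banach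 space $E$ the components $\mathcal{I}_{Lip}(X,E):=Lip_0(X,E)\cap\mathcal{I}_{Lip}$ satisfy: (i) $\mathcal{I}_{Lip}(X,E)$ is a linear subspace of $Lip_0(X,E)$; (ii) $vg:x\mapsto g(x)v$ belongs to $\mathcal{I}_{Lip}(X,E)$ for $v\in E$, $g\in X^{\#}$; (iii) if $S\in Lip_0(Y,X)$, $T\in\mathcal{I}_{Lip}(X,E)$, $w\in\mathcal{L}(E,F)$, then $wTS\in\mathcal{I}_{Lip}(Y,F)$. Strong factorization method: $T\in BLip_0(X_1,X_2;E)$ belongs to $\mathcal{B}(\mathcal{I}_{Lip}^{1},\mathcal{I}_{Lip}^{2})(X_1,X_2;E)$ iff there are Banach spaces $G_1,G_2$, $f_j\in\mathcal{I}_{Lip}^{j}(X_j,G_j)$ ($j=1,2$) and $R\in\mathcal{B}(G_1,G_2;E)$ with $T=R\circ(f_1,f_2)$. For $T\in BLip_0(X,X;E)$, its symmetrization $T^s\in BLip_0(X,X;E)$ is $T^s(x_1,x_2)=\frac12(T(x_1,x_2)+T(x_2,x_1))$. A two-Lipschitz operator ideal $\mathcal{I}_{BLip}$ is symmetric if, for every pointed metric space $X$ and Banach space $E$, $T^s\in\mathcal{I}_{BLip}(X,X;E)$ whenever $T\in\mathcal{I}_{BLip}(X,X;E)$. Equalities of classes mean equality of all components. *)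

(* Defs.v *)
From HB Require Import structures.
From mathcomp Require Import all_boot all_order all_algebra.
From mathcomp Require Import all_classical all_reals all_analysis.
From mathcomp Require Import complex.

Set Implicit Arguments.
Unset Strict Implicit.
Unset Printing Implicit Defensive.

Import Order.TTheory GRing.Theory Num.Theory.
Import numFieldNormedType.Exports.

Local Open Scope classical_set_scope.
Local Open Scope ring_scope.

Variant scalar_field := RealScalars | ComplexScalars.

Definition scalars (R : realType) (k : scalar_field) : numFieldType :=
  match k with
  | RealScalars => R
  | ComplexScalars => R[i]
  end.

(* In MathComp-Analysis the norm of a normed module over K is K-valued (its
   values are nonnegative, hence real, elements of K), whereas the distances of
   metric spaces below are elements of R: real quantities are injected into the
   scalar field before being compared with norms. *)
Definition of_real (R : realType) (k : scalar_field) : R -> scalars R k :=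
  match k return R -> scalars R k with
  | RealScalars => fun r => r
  | ComplexScalars => fun r => real_complex R r
  end.

(* The distinguished base point 0 is the library's [point]. *)
#[short(type="pointedMetricType")]
HB.structure Definition PointedMetric (R : numDomainType) :=
  { X of Pointed X & Metric R X }.

Section TwoLipschitz.
Context {R : realType} {k : scalar_field}.
Local Notation K := (scalars R k).
Local Notation "r %:K" := (@of_real R k r) (at level 2, format "r %:K").

Definition Lip0_metric (Y X : pointedMetricType R) : set (Y -> X) :=
  [set S | S point = point /\
    exists C : R, forall y y', mdist (S y) (S y') <= C * mdist y y'].

(* The Lipschitz maps into a normed space that vanish at the base point; the
   codomain is any normed space so that X^# is the case E = K. *)
Definition Lip0 (X : pointedMetricType R) (E : normedModType K) :
    set (X -> E) :=
  [set T | T point = 0 /\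
    exists C : R, forall x x', `|T x - T x'| <= (C * mdist x x')%:K].

Definition Lip_dual (X : pointedMetricType R) : set (X -> K^o) :=
  @Lip0 X K^o.

Definition bounded_linear (E F : normedModType K) (w : {linear E -> F}) :=
  exists M : R, forall x, `|w x| <= M%:K * `|x|.

Definition bounded_bilinear (G1 G2 E : normedModType K)
    (B : {bilinear G1 -> G2 -> E}) :=
  exists M : R, forall x y, `|B x y| <= M%:K * `|x| * `|y|.

Definition BLip0 (X1 X2 : pointedMetricType R) (E : normedModType K) :
    set (X1 -> X2 -> E) :=
  [set T | [/\ forall x1, T x1 point = 0,
               forall x2, T point x2 = 0 &
               exists2 C : R, 0 < C & forall x1 x1' x2 x2',
                 `|T x1 x2 - T x1 x2' - T x1' x2 + T x1' x2'|
                   <= (C * mdist x1 x1' * mdist x2 x2')%:K]].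

(* A class of maps from pointed metric spaces to Banach spaces is given by the
   family of its components. *)
Definition lip_class :=
  forall (X : pointedMetricType R) (E : completeNormedModType K), set (X -> E).

Definition bilip_class :=
  forall (X1 X2 : pointedMetricType R) (E : completeNormedModType K),
    set (X1 -> X2 -> E).

Definition eq_lip_class (I J : lip_class) :=
  forall (X : pointedMetricType R) (E : completeNormedModType K),
    I X E = J X E.

Definition eq_bilip_class (I J : bilip_class) :=
  forall (X1 X2 : pointedMetricType R) (E : completeNormedModType K),
    I X1 X2 E = J X1 X2 E.

Record lip_operator_ideal (I : lip_class) : Prop := {
  lip_ideal_sub : forall (X : pointedMetricType R)
    (E : completeNormedModType K), I X E `<=` Lip0 (E := E);
  lip_ideal0 : forall (X : pointedMetricType R)
    (E : completeNormedModType K), I X E (fun=> 0);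
  lip_idealD : forall (X : pointedMetricType R) (E : completeNormedModType K)
    (f g : X -> E), I X E f -> I X E g -> I X E (fun x => f x + g x);
  lip_idealZ : forall (X : pointedMetricType R) (E : completeNormedModType K)
    (a : K) (f : X -> E), I X E f -> I X E (fun x => a *: f x);
  lip_ideal_rank1 : forall (X : pointedMetricType R)
    (E : completeNormedModType K) (v : E) (g : X -> K^o),
    Lip_dual g -> I X E (fun x => (g x : K) *: v);
  lip_ideal_comp : forall (X Y : pointedMetricType R)
    (E F : completeNormedModType K)
    (S : Y -> X) (T : X -> E) (w : {linear E -> F}),
    Lip0_metric S -> I X E T -> bounded_linear w ->
    I Y F (fun y => w (T (S y)))
}.

(* B(I1, I2) *)
Definition strong_factorization (I1 I2 : lip_class) : bilip_class :=
  fun X1 X2 E => [set T | BLip0 T /\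
    exists (G1 G2 : completeNormedModType K) (f1 : X1 -> G1) (f2 : X2 -> G2)
           (B : {bilinear G1 -> G2 -> E}),
      [/\ I1 X1 G1 f1, I2 X2 G2 f2, bounded_bilinear B &
          T = fun x1 x2 => B (f1 x1) (f2 x2)]].

Definition symmetrization (X : pointedMetricType R) (E : normedModType K)
    (T : X -> X -> E) : X -> X -> E :=
  fun x1 x2 => 2^-1 *: (T x1 x2 + T x2 x1).

Definition symmetric_class (I : bilip_class) :=
  forall (X : pointedMetricType R) (E : completeNormedModType K)
    (T : X -> X -> E), I X X E T -> I X X E (symmetrization T).

End TwoLipschitz.

Arguments lip_class : clear implicits.
Arguments bilip_class : clear implicits.

(* Main.v *)
From HB Require Import structures.
Require Import Defs.
From mathcomp Require Import all_boot all_order all_algebra.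
From mathcomp Require Import all_classical all_reals all_analysis.
From mathcomp Require Import complex ring.

(** Each implication comes from rewriting factorizations T = B o (f1, f2).

    Symmetry forces the two products to coincide ([symmetric_swap]): regard T
    as a map on (X1 x X2) x (X1 x X2) that reads the first coordinate of its
    first argument and the second coordinate of its second argument. Its
    symmetrization is 1/2 (T(x1, y2) + T(y1, x2)) at ((x1, x2), (y1, y2)), and
    it factors as B' o (g1, g2) with g1 in I1 and g2 in I2. Along x1 = 0 and
    y2 = 0 the first summand dies, so T(y1, x2) = 2 B'(g1(0, x2), g2(y1, 0)),
    where now the I2-map carries the first variable. Transposing both
    variables gives the reverse inclusion.

    Equality of the products forces the ideals to coincide
    ([lip_ideal_sub_of_products]): for f in I1(X, E), the map (x, y) |-> y f(x)
    on X x R belongs to B(I1, I2), because y |-> y has rank one. If it also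
    factors as B o (g1, g2) with g1 in I2, then freezing y = 1 gives
    f = B(-, g2(1)) o g1, a bounded operator after a map of I2.

    Finally B(I, I) is symmetric ([strong_factorization_symmetric]): when f1
    and f2 lie in the same ideal, so does the pair f = (f1, f2) with values in
    G1 x G2, and the symmetrization of B o (f1, f2) is the composite of (f, f)
    with the symmetrized form 1/2 (B(p1, q2) + B(q1, p2)).

    These arguments need products of Banach spaces and of metric spaces, and
    the completeness of the scalar field, which for C is deduced from that of
    R. *)

Set Implicit Arguments.
Unset Strict Implicit.
Unset Printing Implicit Defensive.

Import Order.TTheory GRing.Theory Num.Theory.
Import numFieldNormedType.Exports.

Local Open Scope classical_set_scope.
Local Open Scope ring_scope.

(** * Products of complete spaces and of metric spaces *)

HB.instance Definition _ (U V : ptopologicalType) := Pointed.on (U * V)%type.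
HB.instance Definition _ (U V : puniformType) := Pointed.on (U * V)%type.

Section ProductComplete.
Context {E F : completeType}.

Lemma cauchy_cvg_prod (P : set_system (E * F)) :
  ProperFilter P -> cauchy P -> cvg P.
Proof.
move=> PP Pc.
(* an entourage for pairs contains a product B x C; projecting B and C gives
   the entourage wanted for one coordinate *)
have c1 : cauchy (fst @ P).
  move=> A entA.
  have /Pc : entourage [set xy : (E * F) * (E * F) | A (xy.1.1, xy.2.1)].
    exists (A, setT); first by split => //=; exact: filterT.
    by case=> -[x1 x2] [y1 y2] /= [Axy _]; exists (x1, y1, (x2, y2)).
  case=> -[B C] /= [PB PC] BCA; exists (fst @` B, fst @` C).
    by split; [apply: filterS PB | apply: filterS PC] => x ?; exists x.
  by case=> _ _ [/= [x Bx <-] [y Cy <-]]; exact: (BCA (x, y)).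
have c2 : cauchy (snd @ P).
  move=> A entA.
  have /Pc : entourage [set xy : (E * F) * (E * F) | A (xy.1.2, xy.2.2)].
    exists (setT, A); first by split => //=; exact: filterT.
    by case=> -[x1 x2] [y1 y2] /= [_ Axy]; exists (x1, y1, (x2, y2)).
  case=> -[B C] /= [PB PC] BCA; exists (snd @` B, snd @` C).
    by split; [apply: filterS PB | apply: filterS PC] => x ?; exists x.
  by case=> _ _ [/= [x Bx <-] [y Cy <-]]; exact: (BCA (x, y)).
have cv1 : cvg (fst @ P) by exact: cauchy_cvg.
have cv2 : cvg (snd @ P) by exact: cauchy_cvg.
apply: (cvgP (lim (fst @ P), lim (snd @ P))) => A.
have cv : (x.1, x.2) @[x --> P] --> (lim (fst @ P), lim (snd @ P)).
  exact: cvg_pair.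
move=> /cv; rewrite /nbhs /=; suff -> : (fun x => (x.1, x.2)) @^-1` A = A by [].
by apply/seteqP; split=> -[].
Qed.

HB.instance Definition _ :=
  Uniform_isComplete.Build (E * F)%type cauchy_cvg_prod.

End ProductComplete.

HB.instance Definition _ (K : numFieldType) (E F : completeNormedModType K) :=
  Complete.on (E * F)%type.

Section ProductMetric.
Context {R : realFieldType} {X Y : metricType R}.
Implicit Types p q : (X * Y)%type.

Let pdist p q := Num.max (mdist p.1 q.1) (mdist p.2 q.2).

Let pdist_ge0 p q : 0 <= pdist p q.
Proof. by rewrite le_max mdist_ge0. Qed.

Let pdist_positivity p q : pdist p q = 0 -> p = q.
Proof.
case: p q => [x y] [x' y'] d0.
have : pdist (x, y) (x', y') <= 0 by rewrite d0.
rewrite ge_max => /andP[dx dy].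
by congr pair; apply: mdist_positivity; apply/eqP;
  rewrite eq_le mdist_ge0 andbT.
Qed.

Let ball_pdist p d : ball p d = [set q | pdist p q < d].
Proof.
apply/seteqP; split => q; rewrite /= /ball /= /prod_ball !ballEmdist /= gt_max.
  by move=> [-> ->].
by move=> /andP.
Qed.

HB.instance Definition _ := PseudoMetric_isMetric.Build R (X * Y)%type
  pdist_ge0 pdist_positivity ball_pdist.

Lemma mdist_prodE p q : mdist p q = Num.max (mdist p.1 q.1) (mdist p.2 q.2).
Proof. by []. Qed.
End ProductMetric.

HB.instance Definition _ (R : realFieldType) (X Y : pointedMetricType R) :=
  Pointed.on (X * Y)%type.

Lemma norm_fst_le (K : numFieldType) (E F : normedModType K) (p : E * F) :
  `|p.1| <= `|p|.
Proof. by rewrite prod_normE comparable_le_max ?lexx ?real_comparable. Qed.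

Lemma norm_snd_le (K : numFieldType) (E F : normedModType K) (p : E * F) :
  `|p.2| <= `|p|.
Proof.
by rewrite prod_normE comparable_le_max ?lexx ?orbT ?real_comparable.
Qed.

(** * The scalar field as a Banach space *)

(** The pointed metric space on which the maps (x, y) |-> y f(x) are tested. *)
Definition real_line (R : realType) : Type := R^o.
HB.instance Definition _ (R : realType) := Metric.copy (real_line R) R^o.
HB.instance Definition _ (R : realType) := Pointed.copy (real_line R) R^o.

Lemma mdist_real_line (R : realType) (x y : real_line R) :
  mdist x y = `|(y : R) - x|.
Proof. by []. Qed.

Lemma point_real_line (R : realType) : (point : real_line R) = (0 : R).
Proof. by []. Qed.

Section Scalars.
Variable R : realType.

Lemma normc_real (x : R) : `|x%:C%C| = `|x|%:C%C.
Proof. by rewrite normc_def /= expr0n addr0 sqrtr_sqr. Qed.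

Lemma normci : `|'i%C : R[i]| = 1.
Proof. by rewrite normc_def /= expr0n expr1n add0r sqrtr1. Qed.

Lemma normc_ge_Im (x : R[i]) : `|complex.Im x|%:C%C <= `|x|.
Proof.
have := normc_ge_Re (x * 'i%C).
by rewrite ReiNIm normrN normrM normci mulr1.
Qed.

(** The real and imaginary parts are 1-Lipschitz, so they map a Cauchy filter
    to Cauchy filters of R, and the modulus is at most the sum of their absolute
    values. *)
Lemma complex_cauchy_cvg (F : set_system R[i]^o) :
  ProperFilter F -> cauchy F -> cvg F.
Proof.
move=> FF /cauchyP Fc.
(* [p] stands for the real part and for the imaginary part *)
have cauchy_part (p : R[i]^o -> R) :
    (forall x y, `|p x - p y|%:C%C <= `|x - y|) -> cauchy (p @ F).
  move=> p1; apply: cauchy_exP => e e0.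
  have e0C : 0 < e%:C%C by rewrite ltcR.
  have [x Fx] := Fc _ e0C; exists (p x).
  suff : F (p @^-1` ball (p x) e) by [].
  apply: filterS Fx => y; rewrite -!ball_normE /= => xy.
  by have := le_lt_trans (p1 x y) xy; rewrite ltcR.
have cRe : cauchy ((@complex.Re R : R[i]^o -> R) @ F).
  by apply: cauchy_part => x y; rewrite -raddfB normc_ge_Re.
have cIm : cauchy ((@complex.Im R : R[i]^o -> R) @ F).
  by apply: cauchy_part => x y; rewrite -raddfB normc_ge_Im.
have /cvg_ex[a ha] : cvg ((@complex.Re R : R[i]^o -> R) @ F).
  exact: cauchy_cvg.
have /cvg_ex[b hb] : cvg ((@complex.Im R : R[i]^o -> R) @ F).
  exact: cauchy_cvg.
apply/cvg_ex; exists (a +i* b)%C.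
apply/cvgrPdist_lt => e e0.
have [e' e'0 ee'] : exists2 e' : R, 0 < e' & e = e'%:C%C.
  by case: e e0 => e' ei; rewrite ltcE /= => /andP[/eqP -> ?]; exists e'.
have e20 : 0 < e' / 2 by rewrite divr_gt0.
move: ha hb => /cvgrPdist_lt/(_ _ e20) ha /cvgrPdist_lt/(_ _ e20) hb.
near=> z.
rewrite [_ - _]complexE (le_lt_trans (ler_normD _ _))//.
rewrite normrM normci mul1r !normc_real -rmorphD /= ee' ltcR.
rewrite (splitr e') ltrD//.
  by rewrite raddfB /=; near: z.
by rewrite raddfB /=; near: z.
Unshelve. all: by end_near. Qed.

Lemma scalars_cauchy_cvg (k : scalar_field) (F : set_system (scalars R k)^o) :
  ProperFilter F -> cauchy F -> cvg F.
Proof.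
case: k F => F FF; first exact: (@cauchy_cvg R^o).
exact: complex_cauchy_cvg.
Qed.

(** The scalar field as a Banach space over itself. It has a name of its own so
    as to carry a completeness proof by cases on the field. *)
Definition scalar_line (k : scalar_field) : Type := (scalars R k)^o.

Section scalar_line.
Variable k : scalar_field.
HB.instance Definition _ := NormedModule.copy (scalar_line k) (scalars R k)^o.
HB.instance Definition _ := Pointed.copy (scalar_line k) (scalars R k)^o.
HB.instance Definition _ :=
  Uniform_isComplete.Build (scalar_line k) (@scalars_cauchy_cvg k).
End scalar_line.
End Scalars.

Section ScalarInjection.
Context {R : realType} {k : scalar_field}.
Local Notation K := (scalars R k).
Local Notation "r %:K" := (@of_real R k r) (at level 2, format "r %:K").

Lemma of_real1 : 1%:K = 1.
Proof. by case: k. Qed.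

Lemma of_realM (x y : R) : (x * y)%:K = x%:K * y%:K.
Proof. by case: k => //=; rewrite -rmorphM. Qed.

Lemma of_realB (x y : R) : (x - y)%:K = x%:K - y%:K.
Proof. by case: k => //=; rewrite -rmorphB. Qed.

Lemma of_real_le (x y : R) : x <= y -> x%:K <= y%:K.
Proof. by case: k => //=; rewrite lecR. Qed.

Lemma of_real_ge0 (x : R) : 0 <= x -> 0 <= x%:K.
Proof. by case: k => //=; rewrite ler0c. Qed.

Lemma of_real_nat n : (n%:R : R)%:K = n%:R.
Proof. by case: k => //=; rewrite rmorph_nat. Qed.

Lemma ge0_of_real (a : K) : 0 <= a -> exists2 r : R, 0 <= r & a = r%:K.
Proof.
case: k a => /= [a a_ge0|[a b]]; first by exists a.
by rewrite lecE /= => /andP[/eqP -> a_ge0]; exists a.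
Qed.

Lemma norm_of_real (x : R) : `|x%:K| = `|x|%:K.
Proof. by case: k => //=; rewrite normc_real. Qed.

End ScalarInjection.

(** * Lipschitz ideals and bilinear maps *)

Lemma linear_ex (K : numFieldType) (E F : normedModType K) (w : E -> F) :
  linear w -> exists u : {linear E -> F}, w = u.
Proof.
move=> lw; pose m := GRing.isLinear.Build _ _ _ _ _ lw.
by pose u : {linear E -> F} := HB.pack w m; exists u.
Qed.

Lemma bilinear_ex (K : numFieldType) (E F G : normedModType K)
    (b : E -> F -> G) :
  (forall y, linear (b^~ y)) -> (forall x, linear (b x)) ->
  exists B : {bilinear E -> F -> G}, b = B.
Proof.
move=> bl br; have b2 : bilinear_for *:%R *:%R b by [].
pose m := bilinear_isBilinear.Build _ _ _ _ _ _ _ b2.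
by pose B : {bilinear E -> F -> G} := HB.pack b m; exists B.
Qed.

Section Factorization.
Context {R : realType} {k : scalar_field}.
Local Notation K := (scalars R k).
Local Notation "r %:K" := (@of_real R k r) (at level 2, format "r %:K").

Lemma Lip0_bound (X : pointedMetricType R) (E : normedModType K) (f : X -> E) :
  Lip0 f ->
  exists2 C : R, 0 <= C & forall x x', `|f x - f x'| <= (C * mdist x x')%:K.
Proof.
move=> [_ [C fC]]; exists `|C| => // x x'.
apply: le_trans (fC x x') _; apply: of_real_le.
by rewrite ler_wpM2r ?mdist_ge0 ?ler_norm.
Qed.

(** The mixed second difference of b o (f1, f2) is b evaluated at the increments
    of f1 and f2, so the two-Lipschitz condition follows from the factorization
    itself. *)
Lemma strong_factorization_intro (I1 I2 : lip_class R k)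
    (hI1 : lip_operator_ideal I1) (hI2 : lip_operator_ideal I2)
    (X1 X2 : pointedMetricType R) (G1 G2 E : completeNormedModType K)
    (f1 : X1 -> G1) (f2 : X2 -> G2) (b : G1 -> G2 -> E) (M : R) :
  (forall y, linear (b^~ y)) -> (forall x, linear (b x)) ->
  (forall x y, `|b x y| <= M%:K * `|x| * `|y|) ->
  I1 X1 G1 f1 -> I2 X2 G2 f2 ->
  strong_factorization I1 I2 (fun x1 x2 => b (f1 x1) (f2 x2)).
Proof.
move=> bl br bM If1 If2; have [B bB] := bilinear_ex bl br.
split; last first.
  exists G1, G2, f1, f2, B; split; rewrite -?bB //.
  by exists M => x y; rewrite -bB.
have [f10 _] := lip_ideal_sub hI1 If1.
have [f20 _] := lip_ideal_sub hI2 If2.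
have [C1 C1_ge0 f1C] := Lip0_bound (lip_ideal_sub hI1 If1).
have [C2 C2_ge0 f2C] := Lip0_bound (lip_ideal_sub hI2 If2).
split=> [x1|x2|]; first by rewrite f20 bB linear0r.
  by rewrite f10 bB linear0l.
(* the summand 1 makes the constant positive *)
exists (`|M| * C1 * C2 + 1); first by rewrite ltr_wpDl ?mulr_ge0.
move=> x1 x1' x2 x2'.
have -> : b (f1 x1) (f2 x2) - b (f1 x1) (f2 x2') - b (f1 x1') (f2 x2)
    + b (f1 x1') (f2 x2') = b (f1 x1 - f1 x1') (f2 x2 - f2 x2').
  by rewrite bB linearBl !linearBr opprB addrA addrAC.
apply: le_trans (bM _ _) _.
apply: (@le_trans _ _ (`|M| * (C1 * mdist x1 x1') * (C2 * mdist x2 x2'))%:K).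
  rewrite !(of_realM (_ * _) (_ * mdist x2 x2')) (of_realM `|M|).
  apply: (@le_trans _ _ (`|M|%:K * `|f1 x1 - f1 x1'| * `|f2 x2 - f2 x2'|)).
    by rewrite !ler_wpM2r// of_real_le// ler_norm.
  by rewrite ler_pM ?mulr_ge0 ?of_real_ge0// ler_wpM2l ?of_real_ge0.
apply: of_real_le; rewrite [leLHS](_ : _ =
  `|M| * C1 * C2 * mdist x1 x1' * mdist x2 x2'); last by ring.
by rewrite !ler_wpM2r ?mdist_ge0// lerDl.
Qed.

(** This and the next lemma are the two halves of the ideal property: the other
    outer map is the identity. *)
Lemma lip_ideal_precomp (I : lip_class R k) (hI : lip_operator_ideal I)
    (X Y : pointedMetricType R) (E : completeNormedModType K)
    (S : Y -> X) (f : X -> E) (C : R) :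
  S point = point -> (forall y y', mdist (S y) (S y') <= C * mdist y y') ->
  I X E f -> I Y E (fun y => f (S y)).
Proof.
move=> S0 SC If.
have S_lip : Lip0_metric S by split=> //; exists C.
apply: (lip_ideal_comp hI (w := idfun) S_lip If).
by exists 1 => x; rewrite of_real1 mul1r.
Qed.

Lemma lip_ideal_postcomp (I : lip_class R k) (hI : lip_operator_ideal I)
    (X : pointedMetricType R) (E F : completeNormedModType K)
    (f : X -> E) (w : E -> F) (M : R) :
  linear w -> (forall e, `|w e| <= M%:K * `|e|) ->
  I X E f -> I X F (fun x => w (f x)).
Proof.
move=> lw wM If; have [u wu] := linear_ex lw; rewrite wu in wM *.
have id_lip : Lip0_metric (@id X) by split=> //; exists 1 => x y; rewrite mul1r.
by apply: (lip_ideal_comp hI id_lip If); exists M.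
Qed.

Lemma bilinear_bound (E F G : normedModType K) (B : {bilinear E -> F -> G}) :
  bounded_bilinear B ->
  exists2 M : R, 0 <= M & forall x y, `|B x y| <= M%:K * `|x| * `|y|.
Proof.
move=> [M BM]; exists `|M| => // x y; apply: le_trans (BM x y) _.
by rewrite !ler_wpM2r// of_real_le// ler_norm.
Qed.

Lemma linear_left (E F G : normedModType K) (B : {bilinear E -> F -> G}) y :
  linear (B^~ y).
Proof. by move=> a u v; rewrite linearDl linearZl_LR. Qed.

Lemma linear_right (E F G : normedModType K) (B : {bilinear E -> F -> G}) x :
  linear (B x).
Proof. by move=> a u v; rewrite linearDr linearZr_LR. Qed.

(** The symmetrization over X1 x X2 is a sum of two copies of T in which the
    roles of its two arguments are exchanged; on {0} x X2 and X1 x {0} only the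
    exchanged copy survives. *)
Lemma symmetric_swap (I1 I2 : lip_class R k)
    (hI1 : lip_operator_ideal I1) (hI2 : lip_operator_ideal I2) :
  symmetric_class (strong_factorization I1 I2) ->
  forall (X1 X2 : pointedMetricType R) (E : completeNormedModType K)
    (T : X1 -> X2 -> E),
  strong_factorization I1 I2 T -> strong_factorization I2 I1 T.
Proof.
move=> sym X1 X2 E T [[_ T0 _] [G1 [G2 [f1 [f2 [B [If1 If2 Bb TB]]]]]]].
have [M M_ge0 BM] := bilinear_bound Bb.
pose P : pointedMetricType R := (X1 * X2)%type.
have If1P : I1 P G1 (fun p => f1 p.1).
  apply: (lip_ideal_precomp (S := fst) (C := 1) hI1) => // p q.
  by rewrite mul1r mdist_prodE le_max lexx.
have If2P : I2 P G2 (fun p => f2 p.2).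
  apply: (lip_ideal_precomp (S := snd) (C := 1) hI2) => // p q.
  by rewrite mul1r mdist_prodE le_max lexx orbT.
have := strong_factorization_intro hI1 hI2 (linear_left B) (linear_right B)
  BM If1P If2P.
move=> /sym [_ [H1 [H2 [g1 [g2 [B' [Ig1 Ig2 B'b TB']]]]]]].
have [N N_ge0 B'N] := bilinear_bound B'b.
have Tg x1 x2 : T x1 x2 = 2 *: B' (g1 (point, x2)) (g2 (x1, point)).
  have := congr1 (fun t : P -> P -> E => t (point, x2) (x1, point)) TB'.
  rewrite /symmetrization /= => <-.
  have := T0 point; rewrite TB => ->.
  by rewrite add0r scalerA divff ?scale1r ?pnatr_eq0.
have -> : T = fun x1 x2 => 2 *: B' (g1 (point, x2)) (g2 (x1, point)).
  by apply/funext => x1; apply/funext => x2.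
apply: (strong_factorization_intro hI2 hI1 (M := 2 * N)
  (b := fun v u => 2 *: B' u v) (f1 := fun x1 => g2 (x1, point))
  (f2 := fun x2 => g1 (point, x2))).
- by move=> u a v w; rewrite linear_right scalerDr !scalerA mulrC.
- by move=> v a u w; rewrite linear_left scalerDr !scalerA mulrC.
- move=> v u; rewrite normrZ of_realM -!mulrA [`|v| * _]mulrC !mulrA.
  rewrite normr_nat of_real_nat.
  by rewrite -!mulrA ler_wpM2l// !mulrA.
- apply: (lip_ideal_precomp (S := fun x1 => (x1, point)) (C := 1) hI2) => //.
  move=> y y'.
  by rewrite mul1r mdist_prodE /= mdistxx ge_max lexx mdist_ge0.
- apply: (lip_ideal_precomp (S := fun x2 => (point, x2)) (C := 1) hI1) => //.
  move=> y y'.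
  by rewrite mul1r mdist_prodE /= mdistxx ge_max lexx mdist_ge0.
Qed.

Lemma strong_factorization_transpose (I1 I2 : lip_class R k)
    (hI1 : lip_operator_ideal I1) (hI2 : lip_operator_ideal I2)
    (X1 X2 : pointedMetricType R) (E : completeNormedModType K)
    (T : X1 -> X2 -> E) :
  strong_factorization I1 I2 T ->
  strong_factorization I2 I1 (fun x2 x1 => T x1 x2).
Proof.
move=> [_ [G1 [G2 [f1 [f2 [B [If1 If2 Bb ->]]]]]]].
have [M M_ge0 BM] := bilinear_bound Bb.
apply: (strong_factorization_intro hI2 hI1 (b := fun v u => B u v) (M := M))
  => //.
- exact: linear_right.
- exact: linear_left.
- by move=> x y; rewrite mulrAC.
Qed.

(** A map f of I1 becomes a two-variable map when multiplied by a nonzero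
    function of one real variable, and is recovered by evaluating at 1. *)
Lemma lip_ideal_sub_of_products (I1 I2 : lip_class R k)
    (hI1 : lip_operator_ideal I1) (hI2 : lip_operator_ideal I2) :
  (forall (X1 X2 : pointedMetricType R) (E : completeNormedModType K),
    @strong_factorization R k I1 I2 X1 X2 E `<=`
    @strong_factorization R k I2 I1 X1 X2 E) ->
  forall (X : pointedMetricType R) (E : completeNormedModType K),
    I1 X E `<=` I2 X E.
Proof.
move=> sub X E f If.
pose Y : pointedMetricType R := real_line R.
pose G : completeNormedModType K := scalar_line R k.
pose h (y : Y) : G := of_real k y.
have h_lip : Lip_dual (h : Y -> K^o).
  split; first by rewrite /h point_real_line; case: (k).
  exists 1 => y y'; rewrite mul1r mdist_real_line -norm_of_real of_realB.
  by rewrite distrC.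
have Ih : I2 Y G h.
  have -> : h = fun y => (h y : K) *: (1 : K^o).
    by apply/funext => y; rewrite [RHS]mulr1.
  exact: (lip_ideal_rank1 hI2 (E := G)).
have : strong_factorization I1 I2 (fun x y => (h y : K) *: f x).
  apply: (strong_factorization_intro hI1 hI2 (M := 1)
    (b := fun (e : E) (a : G) => (a : K) *: e) _ _ _ If Ih).
  - by move=> a c u v; rewrite scalerDr !scalerA mulrC.
  - by move=> e c a a'; rewrite scalerDl scalerA.
  - by move=> e a; rewrite of_real1 mul1r normrZ mulrC.
move=> /sub [_ [H1 [H2 [g1 [g2 [B [Ig1 _ [M BM] fB]]]]]]].
have -> : f = fun x => B (g1 x) (g2 1).
  apply/funext => x; have := congr1 (fun t : X -> Y -> E => t x 1) fB.
  by move=> /= <-; rewrite /h of_real1 scale1r.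
have [N N_ge0 gN] := ge0_of_real (normr_ge0 (g2 1)).
apply: (lip_ideal_postcomp (w := B^~ (g2 1)) (M := M * N) hI2) => //.
  exact: linear_left.
by move=> u; rewrite of_realM -gN mulrAC.
Qed.

(** With a single ideal, f1 and f2 merge into one ideal map (f1, f2), which
    serves for both variables. *)
Lemma strong_factorization_symmetric (I : lip_class R k)
    (hI : lip_operator_ideal I) :
  symmetric_class (strong_factorization I I).
Proof.
move=> X E T [_ [G1 [G2 [f1 [f2 [B [If1 If2 Bb ->]]]]]]].
have [M M_ge0 BM] := bilinear_bound Bb.
pose G : completeNormedModType K := (G1 * G2)%type.
have If : I X G (fun x => (f1 x, f2 x)).
  have -> : (fun x => (f1 x, f2 x)) =
      (fun x => (f1 x, 0) + (0, f2 x)) :> (X -> G).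
    by apply/funext => x; rewrite -[RHS]/(f1 x + 0, 0 + f2 x) addr0 add0r.
  apply: (lip_idealD hI).
    apply: (lip_ideal_postcomp (w := fun u => (u, 0) : G) (M := 1) hI) => //.
      by move=> a u v; rewrite -[RHS]/(a *: u + v, a *: 0 + 0) scaler0 addr0.
    by move=> u; rewrite of_real1 mul1r prod_normE /= normr0 max_l.
  apply: (lip_ideal_postcomp (w := fun u => (0, u) : G) (M := 1) hI) => //.
    by move=> a u v; rewrite -[RHS]/(a *: 0 + 0, a *: u + v) scaler0 addr0.
  by move=> u; rewrite of_real1 mul1r prod_normE /= normr0 max_r.
apply: (strong_factorization_intro hI hI (G1 := G) (G2 := G)
  (f1 := fun x => (f1 x, f2 x)) (f2 := fun x => (f1 x, f2 x)) (M := M)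
  (b := fun p q : G => 2^-1 *: (B p.1 q.2 + B q.1 p.2))) => //.
- move=> q a p p' /=; rewrite !linear_left !linear_right.
  by rewrite addrACA -(scalerDr a) [LHS]scalerDr !scalerA mulrC.
- move=> q a p p' /=; rewrite !linear_left !linear_right.
  by rewrite addrACA -(scalerDr a) [LHS]scalerDr !scalerA mulrC.
- move=> p q.
  rewrite normrZ normfV normr_nat ler_pdivrMl// mulr_natl mulr2n.
  apply: le_trans (ler_normD _ _) _; apply: lerD; apply: le_trans (BM _ _) _.
    by rewrite -!mulrA ler_wpM2l ?of_real_ge0//
               ler_pM ?norm_fst_le ?norm_snd_le.
  rewrite -!mulrA ler_wpM2l ?of_real_ge0// mulrC.
  by rewrite ler_pM ?norm_fst_le ?norm_snd_le.
Qed.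

End Factorization.

Theorem theorem5p16 (R : realType) (k : scalar_field) (I1 I2 : lip_class R k)
    (hI1 : lip_operator_ideal I1) (hI2 : lip_operator_ideal I2) :
  [<-> symmetric_class (strong_factorization I1 I2);
       eq_bilip_class (strong_factorization I1 I2)
                      (strong_factorization I2 I1);
       eq_lip_class I1 I2].
Proof.
split.
  move=> sym X1 X2 E; apply/seteqP; split=> T.
    exact: symmetric_swap.
  move=> /(strong_factorization_transpose hI2 hI1).
  move=> /(symmetric_swap hI1 hI2 sym).
  exact: strong_factorization_transpose.
split.
  move=> eqB X E; apply/seteqP; split.
    by apply: lip_ideal_sub_of_products => // X1 X2 F T; rewrite eqB.
  by apply: lip_ideal_sub_of_products => // X1 X2 F T; rewrite eqB.
move=> eqI; have <- : I1 = I2.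
  apply: functional_extensionality_dep => X.
  exact: functional_extensionality_dep.
exact: strong_factorization_symmetric.
Qed.
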